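(* Let $\mathcal{R} = \langle R, \lesssim\rangle$ be a rulebook on $\mathcal{T}\times\mathcal{E}$ in which every rule $r\in R$ is measurable and is equipped with a risk measure $\rho_r : \mathcal{F}(\Omega,\mathbb{R})\to\mathbb{R}$ and a threshold $\gamma_r\in\mathbb{R}$, and let $\mathcal{R}_{\text{risk}}$ be the induced risk-aware rulebook on $\mathcal{T}$. Then the following hold, where ''safe'' and ''optimal'' are with respect to $\mathcal{R}_{\text{risk}}$. (1) Every safe trajectory in $\mathcal{T}$ is optimal. (2) If $\tau\in\mathcal{T}$ is safe, then any $\tau'\in\mathcal{T}$ with $\tau'\lesssim_{\mathcal{R}_{\text{risk}}}\tau$ is also safe and optimal. (3) If a safe trajectory exists in $\mathcal{T}$, then a trajectory in $\mathcal{T}$ is safe if and only if it is optimal.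
   Context: A preorder $\lesssim$ is a reflexive and transitive binary relation; its strict part is: $a<b$ iff $a\lesssim b$ and not $b\lesssim a$ (also written $b>a$). A rule on a set $\Xi$ is a function $\Xi\to\mathbb{R}_{\ge 0}$. A rulebook on $\Xi$ is a tuple $\langle R,\lesssim\rangle$ where $R$ is a finite set of rules on $\Xi$ and $\lesssim$ is a preorder on $R$; $r'>r$ means $r'$ has higher priority than $r$. Setting: $\mathcal{T}$ (system trajectories) and $\mathcal{E}$ (environment trajectories) are standard Borel spaces; $(\Omega,\Sigma,\mathit{Pr})$ is a probability space with $\Omega$ nonempty and $\Sigma$ standard Borel; $\mathbf{E}:\mathcal{T}\times\Omega\to\mathcal{E}$ is a Borel function, and $\mathbf{E}_\tau(\omega)=\mathbf{E}(\tau,\omega)$. $\mathcal{F}(\Omega,\mathbb{R})$ is the set of measurable functions $\Omega\to\mathbb{R}$. A risk measure is a map $\mathcal{F}(\Omega,\mathbb{R})\to\mathbb{R}$. For a measurable rule $r:\mathcal{T}\times\mathcal{E}\to\mathbb{R}_{\ge 0}$ with risk measure $\rho_r$ and threshold $\gamma_r$, and $\tau\in\mathcal{T}$, let $r_\tau:\Omega\to\mathbb{R}_{\ge 0}$, $r_\tau(\omega)=r(\tau,\mathbf{E}_\tau(\omega))$ (a measurable function). The risk-aware rule induced by $(r,\rho_r,\gamma_r)$ is $r_{\text{risk}}:\mathcal{T}\to\mathbb{R}_{\ge 0}$, $r_{\text{risk}}(\tau)=\max\{\rho_r(r_\tau)-\gamma_r,0\}$. The induced risk-aware rulebook is $\mathcal{R}_{\text{risk}}=\langle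 R_{\text{risk}},\lesssim_{\text{risk}}\rangle$ with $R_{\text{risk}}=\{r_{\text{risk}} \mid r\in R\}$ and $r_{\text{risk}}\lesssim_{\text{risk}} r'_{\text{risk}}$ if and only if $r\lesssim r'$. Here the elements of $R_{\text{risk}}$ are regarded as indexed by $R$ (distinct rules give distinct elements even if the functions coincide). For $\tau,\tau'\in\mathcal{T}$: $\tau\lesssim_{\mathcal{R}_{\text{risk}}}\tau'$ iff for every $r_{\text{risk}}\in R_{\text{risk}}$ with $r_{\text{risk}}(\tau)>r_{\text{risk}}(\tau')$ there exists $r'_{\text{risk}}>_{\text{risk}} r_{\text{risk}}$ with $r'_{\text{risk}}(\tau')>r'_{\text{risk}}(\tau)$. And $\tau<_{\mathcal{R}_{\text{risk}}}\tau'$ iff $\tau\lesssim_{\mathcal{R}_{\text{risk}}}\tau'$ but not $\tau'\lesssim_{\mathcal{R}_{\text{risk}}}\tau$. A trajectory $\tau\in\mathcal{T}$ is safe if $r_{\text{risk}}(\tau)=0$ for all $r_{\text{risk}}\in R_{\text{risk}}$. A trajectory $\tau^*\in\mathcal{T}$ is optimal if there is no $\tau\in\mathcal{T}$ with $\tau<_{\mathcal{R}_{\text{risk}}}\tau^*$. *)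

(* Defs.v *)
From HB Require Import structures.
From mathcomp Require Import all_boot all_order all_algebra.
From mathcomp Require Import all_classical all_reals all_analysis.
Set Implicit Arguments.
Unset Strict Implicit.
Unset Printing Implicit Defensive.
Import Order.TTheory GRing.Theory Num.Theory.
Local Open Scope classical_set_scope.
Local Open Scope ring_scope.

(* T carries the Borel sigma-algebra of some complete separable metric: the
   metric is given on a type M in bijection with T. Completeness is spelled out
   because the library's complete uniform types are not joined with metricType. *)
Definition standard_borel (R : realType) d (T : measurableType d) : Prop :=
  exists (M : metricType R) (f : T -> M),
    [/\ forall F : set_system M,
          ProperFilter F -> cauchy F -> exists x : M, F --> x,
        exists2 D : set M, countable D & dense D,
        bijective f &
        forall A : set M, measurable (f @^-1` A) <-> <<s [set U | open U] >> A].

Definition strict_part A (le : A -> A -> Prop) (a b : A) : Prop :=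
  le a b /\ ~ le b a.

Definition rule (R : realType) (Xi : Type) := Xi -> {nonneg R}.

(* priority r r' is r <~ r': r' has at least the priority of r. *)
Record rulebook (R : realType) (Xi : Type) := Rulebook {
  rules : set (rule R Xi);
  rules_finite : finite_set rules;
  priority : rules -> rules -> Prop;
  priority_preorder : Relation_Definitions.preorder rules priority }.

(* A rulebook whose rules are told apart by their indices, so that distinct
   indices count as distinct rules even when the two functions coincide. *)
Record indexed_rulebook (R : realType) (Xi : Type) := IndexedRulebook {
  index : Type;
  index_finite : finite_set [set: index];
  rule_of : index -> rule R Xi;
  index_priority : index -> index -> Prop;
  index_priority_preorder :
    Relation_Definitions.preorder index index_priority }.

Section preference.
Variables (R : realType) (Xi : Type) (B : indexed_rulebook R Xi).

(* rb_le x y is x <~ y: smaller is preferred, as rules measure violation. *)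
Definition rb_le (x y : Xi) : Prop :=
  forall i : index B, (rule_of i x)%:num > (rule_of i y)%:num ->
  exists i' : index B, strict_part (@index_priority R Xi B) i i' /\
    (rule_of i' y)%:num > (rule_of i' x)%:num.

Definition rb_lt : Xi -> Xi -> Prop := strict_part rb_le.

Definition safe (x : Xi) : Prop := forall i : index B, (rule_of i x)%:num = 0.

Definition optimal (x : Xi) : Prop := ~ exists y : Xi, rb_lt y x.

End preference.

Definition risk_measure (R : realType) d (Omega : measurableType d) :=
  {mfun Omega >-> R} -> R.

Definition measurable_rule (R : realType) d (X : measurableType d)
    (r : rule R X) : Prop :=
  measurable_fun [set: X] (fun x => (r x)%:num : R).

Section risk_aware.
Context (R : realType) (dT dE dO : measure_display)
  (T : measurableType dT) (E : measurableType dE) (Omega : measurableType dO).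
Variable env : {mfun (T * Omega)%type >-> E}.

Lemma rule_at_mfun (r : rule R (T * E)%type) (mr : measurable_rule r) (tau : T) :
  (fun w : Omega => (r (tau, env (tau, w)))%:num : R) \in mfun.
Proof.
rewrite inE /=.
apply: (measurableT_comp mr).
apply: measurable_fun_pair; first exact: measurable_cst.
by apply: (measurableT_comp (measurable_funPT env)); exact: pair1_measurable.
Qed.

Definition rule_at (r : rule R (T * E)%type) (mr : measurable_rule r) (tau : T)
  : {mfun Omega >-> R} := mfun_Sub (rule_at_mfun mr tau).

Lemma risk_rule_ge0 (a b : R) : 0 <= Num.max (a - b) 0.
Proof. by rewrite le_max lexx orbT. Qed.

Definition risk_rule (r : rule R (T * E)%type) (mr : measurable_rule r)
    (rho : risk_measure R Omega) (gamma : R) : rule R T :=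
  fun tau => NngNum (risk_rule_ge0 (rho (rule_at mr tau)) gamma).

Lemma set_type_finite (U : Type) (A : set U) :
  finite_set A -> finite_set [set: A].
Proof.
move=> fA; have -> : [set: A] = (@sval _ _ : A -> U) @^-1` A.
  by apply/seteqP; split=> // x _; exact: set_valP.
by apply: finite_preimage => // x y _ _; exact: val_inj.
Qed.

Definition risk_rulebook (B : rulebook R (T * E)%type)
    (mB : forall r : rules B, measurable_rule (\val r))
    (rho : rules B -> risk_measure R Omega) (gamma : rules B -> R)
  : indexed_rulebook R T :=
  IndexedRulebook (set_type_finite (rules_finite B))
    (fun r : rules B => risk_rule (mB r) (rho r) (gamma r))
    (priority_preorder B).

End risk_aware.

(* Main.v *)
(* Rule values are nonnegative, so a safe trajectory minimizes every rule at
   once. It therefore precedes every trajectory, and a trajectory preceding it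
   would need a rule of negative value to compensate for any violation. *)
Require Import Defs.
From HB Require Import structures.
From mathcomp Require Import all_boot all_order all_algebra.
From mathcomp Require Import all_classical all_reals all_analysis.
Import Order.TTheory GRing.Theory Num.Theory.
Local Open Scope classical_set_scope.
Local Open Scope ring_scope.

(** The condition is vacuous: no rule takes at [y] a value below its value 0 at [x]. *)
Lemma safe_rb_le (R : realType) (Xi : Type) (B : indexed_rulebook R Xi)
  (x y : Xi) : safe B x -> rb_le B x y.
Proof. by move=> sx i; rewrite sx ltNge ge0. Qed.

Lemma rb_le_safe (R : realType) (Xi : Type) (B : indexed_rulebook R Xi)
  (x y : Xi) : safe B x -> rb_le B y x -> safe B y.
Proof.
move=> sx yx i; apply/eqP; rewrite eq_le ge0 andbT leNgt; apply/negP => yi_gt0.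
(* A positive value at [y] exceeds the value 0 at [x], so [yx] provides a higher-priority rule [i']
   whose value at [y] would be below 0. *)
have [|i' [_]] := yx i; first by rewrite sx.
by rewrite sx ltNge ge0.
Qed.

Lemma safe_optimal (R : realType) (Xi : Type) (B : indexed_rulebook R Xi)
  (x : Xi) : safe B x -> optimal B x.
Proof. by move=> sx [y [_ nxy]]; apply: nxy; exact: safe_rb_le. Qed.

(** Since [x] precedes [y], optimality of [y] forces [y] to precede [x], as otherwise [x] would be
    strictly preferred; safety then passes from [x] to [y]. *)
Lemma optimal_safe (R : realType) (Xi : Type) (B : indexed_rulebook R Xi)
  (x y : Xi) : safe B x -> optimal B y -> safe B y.
Proof.
move=> sx oy; apply: (rb_le_safe _ _ _ _ _ sx); apply: contrapT => nyx.
by apply: oy; exists x; split=> //; exact: safe_rb_le.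
Qed.

Theorem proposition2 (R : realType) (dT dE dO : measure_display)
  (T : measurableType dT) (E : measurableType dE) (Omega : measurableType dO)
  (hT : standard_borel R T) (hE : standard_borel R E)
  (hOmega0 : [set: Omega] !=set0) (hOmega : standard_borel R Omega)
  (Pr : probability Omega R)
  (env : {mfun (T * Omega)%type >-> E})
  (B : rulebook R (T * E)%type)
  (mB : forall r : rules B, measurable_rule (\val r))
  (rho : rules B -> risk_measure R Omega) (gamma : rules B -> R) :
  let Brisk := risk_rulebook env mB rho gamma in
  [/\ forall tau : T, safe Brisk tau -> optimal Brisk tau,
      forall tau tau' : T, safe Brisk tau -> rb_le Brisk tau' tau ->
        safe Brisk tau' /\ optimal Brisk tau' &
      (exists tau : T, safe Brisk tau) ->
        forall tau : T, safe Brisk tau <-> optimal Brisk tau].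
Proof.
move=> Brisk; split=> [tau|tau tau' stau le_tau|[s ss] tau].
- exact: safe_optimal.
- have stau' := rb_le_safe _ _ _ _ _ stau le_tau.
  by split=> //; exact: safe_optimal.
(* Only the converse uses [s], which is strictly preferred to every unsafe trajectory. *)
- by split; [exact: safe_optimal|exact: optimal_safe ss].
Qed.
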